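(* For any $k$-subset $I$ of $\{1,\dots,n\}$, the twisted Plücker coordinate $\overleftarrow{[I]}$ and the BFZ-twisted Plücker coordinate $\widehat{[I]}$ are related by $$\frac{\widehat{[I]}}{\widehat{[\mathbf{k}]}}=\frac{\overleftarrow{[I]}\cdot[\mathbf{k}]}{\prod_{i\in I}[\mathbf{i}]}$$ as elements of the coordinate ring $\mathbb{C}[\mathrm{Gr}^*_{k,n}]$.
   Context: Let $k\le n$ be positive integers. A point of the Grassmannian $\mathrm{Gr}_{k,n}$ is a complex $k\times n$ matrix $p$ of rank $k$, with columns $p_1,\dots,p_n$, up to left multiplication by $GL_k(\mathbb{C})$. For a $k$-subset $I$, $[I](p)$ is the $k\times k$ minor of $p$ with column set $I$ in increasing order. Let $\sigma(i)=i-1$ reduced modulo $n$ into $\{1,\dots,n\}$, $\mathbf{i}=\{\sigma^{k-1}(i),\dots,\sigma(i),i\}$; in particular $\mathbf{k}=\{1,\dots,k\}$. $\mathrm{Gr}^*_{k,n}$ is the open subvariety of $\mathrm{Gr}_{k,n}$ where $[\mathbf{i}]\ne0$ for all $1\le i\le n$. **Twist.** For $v_1,\dots,v_{k-1}\in\mathbb{C}^k$, $v_1\times\cdots\times v_{k-1}$ is the unique vector with $(v_1\times\cdots\times v_{k-1})^Tv=\det(v_1,\dots,v_{k-1},v)$ for all $v$ (it is $1$ if $k=1$). $\overleftarrow{p}$ is the $k\times n$ matrix with $i$th column $\varepsilon_i\, p_{\sigma^{k-1}(i)}\times\cdots\times p_{\sigma(i)}$, where $\varepsilon_i=(-1)^{i(k-i)}$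 if $i\le k-1$ and $\varepsilon_i=1$ if $i\ge k$; $\overleftarrow{[I]}(p)=[I](\overleftarrow{p})$. **BFZ-twist.** $N$ is the group of complex $n\times n$ upper unitriangular matrices and $B_-$ the group of invertible lower triangular $n\times n$ complex matrices. Let $w\in S_n$ be given by $w(i)=i+k \bmod n$; also write $w$ for any lift of it to $SL_n(\mathbb{C})$ (a monomial matrix whose nonzero entries are in positions $(w(i),i)$). Let $N^w=N\cap B_-wB_-$. For $g\in N^w$, $N\cap B_-wg^T$ consists of a single element, denoted $\eta(g)$; the map $\eta:N^w\to N^w$ is a regular automorphism. The map $q:N^w\to\mathrm{Gr}^*_{k,n}$ sends $g$ to the point represented by its first $k$ rows; it is bijective with (regular) inverse $\varphi:\mathrm{Gr}^*_{k,n}\to N^w$ given by $\varphi(p)_{ij}=[(\mathbf{i}\setminus\{i\})\cup\{j\}](p)/[\mathbf{i}](p)$ if $i\le j+k-1$ (the numerator being $0$ if $j\in\mathbf{i}\setminus\{i\}$) and $\varphi(p)_{ij}=0$ if $i\ge j+k$. The BFZ-twist on $\mathrm{Gr}^*_{k,n}$ is $\widehat{p}=\varphi^{-1}(\eta(\varphi(p)))$, and $\widehat{[I]}$ denotes $p\mapsto[I](\widehat{p})$; only ratios $\widehat{[I]}/\widehat{[\mathbf{k}]}$, which are well-defined functions on $\mathrm{Gr}^*_{k,n}$, are used. *)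

(* Defs.v *)
From HB Require Import structures.
From mathcomp Require Import all_boot all_order all_algebra.
From mathcomp Require Import mpoly.
From mathcomp Require Import complex.
From mathcomp Require Import boolp classical_sets reals.

Set Implicit Arguments.
Unset Strict Implicit.
Unset Printing Implicit Defensive.

Import GRing.Theory.
Local Open Scope ring_scope.

(* Columns are indexed from 0: the column labelled i in {1, ..., n} is the
   ordinal of value i - 1.  A point of Gr_{k,n} is handled through the matrices
   representing it. *)

Section Defs.
Variables (F : fieldType) (k n : nat).
Implicit Types (p : 'M[F]_(k, n)) (g h W : 'M[F]_n) (I : {set 'I_n}).

(* [enum I] lists I in increasing order; only used when #|I| = k. *)
Definition plucker I p : F :=
  \det (\matrix_(a < k, b < k) nth 0 [seq p a j | j <- enum I] b).

(* The map sigma of {1, ..., n} is [ord_pred]. *)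
Definition cyc (i : 'I_n) : {set 'I_n} :=
  [set iter m (@ord_pred n) i | m : 'I_k].

Definition initial_set : {set 'I_n} := [set j : 'I_n | (j < k)%N].

Definition gr_star p : bool :=
  (\rank p == k) && [forall i, plucker (cyc i) p != 0].

Definition ksubsets : {set {set 'I_n}} := [set I : {set 'I_n} | #|I| == k].

(* Gr*_{k,n} is the locus where the product of the n cyclic Pluecker
   coordinates is nonzero, so C[Gr*_{k,n}] is the degree 0 part of the
   localization of the homogeneous coordinate ring of Gr_{k,n} at this product. *)
Definition in_coord_ring (f : 'M[F]_(k, n) -> F) : Prop :=
  exists (m : nat) (P : {mpoly F[#|ksubsets|]}),
    P \is (n * m)%N.-homog /\
    forall p, gr_star p ->
      f p = P.@[fun t => plucker (enum_val t) p]
            / (\prod_(i < n) plucker (cyc i) p) ^+ m.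

Definition eq_in_coord_ring (f1 f2 : 'M[F]_(k, n) -> F) : Prop :=
  [/\ in_coord_ring f1, in_coord_ring f2 &
      forall p, gr_star p -> f1 p = f2 p].

(* The matrix (v_0, ..., v_(k-2), u). *)
Definition cols_with_last (v : nat -> 'cV[F]_k) (u : 'cV[F]_k) : 'M[F]_k :=
  \matrix_(a, b) (if (b < k.-1)%N then v b a 0 else u a 0).

Definition cross (v : nat -> 'cV[F]_k) : 'cV[F]_k :=
  \col_a \det (cols_with_last v (delta_mx a 0)).

Definition twist_sign (i : nat) : F :=
  if (i <= k.-1)%N then (-1) ^+ (i * (k - i))%N else 1.

Definition twist p : 'M[F]_(k, n) :=
  \matrix_(a, j) (twist_sign j.+1 *
    cross (fun b => col (iter (k.-1 - b)%N (@ord_pred n) j) p) a 0).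

Definition upper_unitri g : bool :=
  [forall i : 'I_n, forall j : 'I_n, (j <= i)%N ==> (g i j == (i == j)%:R)].

Definition lower_invertible g : bool :=
  (g \in unitmx) && [forall i : 'I_n, forall j : 'I_n, (i < j)%N ==> (g i j == 0)].

Definition is_lift W : Prop :=
  \det W = 1 /\
  forall r c : 'I_n, (W r c != 0) = (r == (c + k) %% n :> nat)%N.

Definition Nw W : set 'M[F]_n :=
  [set g | upper_unitri g /\
     exists b1 b2, [/\ lower_invertible b1, lower_invertible b2 &
                       g = b1 *m W *m b2]]%classic.

(* For g in [Nw W] this set, N \cap B_- w g^T, has exactly one element, so the
   default value 1 is not used. *)
Definition eta W g : 'M[F]_n :=
  xget 1%:M [set h | upper_unitri h /\
     exists2 b, lower_invertible b & h = b *m W *m g^T]%classic.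

(* The map q : N^w -> Gr*_{k,n}, whose inverse is [phi]. *)
Definition first_rows (hkn : (k <= n)%N) g : 'M[F]_(k, n) :=
  rowsub (widen_ord hkn) g.

Definition phi p : 'M[F]_n :=
  \matrix_(i, j)
    if (i < j + k)%N then
      if j \in cyc i :\ i then 0
      else plucker (j |: (cyc i :\ i)) p / plucker (cyc i) p
    else 0.

Definition bfz_twist (hkn : (k <= n)%N) W p : 'M[F]_(k, n) :=
  first_rows hkn (eta W (phi p)).

End Defs.

Lemma crossP (F : fieldType) (k : nat) (v : nat -> 'cV[F]_k) (x : 'cV[F]_k) :
  (0 < k)%N ->
  x = cross v <->
  forall u : 'cV[F]_k, x^T *m u = (\det (cols_with_last v u))%:M.
Proof.
case: k v x => // k v x _.
have detE u : \det (cols_with_last v u)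
    = \sum_a u a 0 * cofactor (cols_with_last v 0) a ord_max.
  rewrite (expand_det_col _ ord_max); apply: eq_bigr => a _.
  rewrite mxE /= ltnn; congr (_ * (_ * \det _)).
  apply/matrixP=> r c; rewrite !mxE /=.
  have lt_ck : (lift ord_max c < k)%N by rewrite lift_max ltn_ord.
  by rewrite lt_ck.
have crossE a : cross v a 0 = cofactor (cols_with_last v 0) a ord_max.
  rewrite mxE detE (bigD1 a) //= big1 => [|b ne_ba].
    by rewrite mxE !eqxx mul1r addr0.
  by rewrite mxE (negPf ne_ba) mul0r.
split=> [-> u | xP].
  apply/matrixP=> r c; rewrite !ord1 !mxE /= mulr1n detE.
  by apply: eq_bigr => a _; rewrite mxE crossE mulrC.
apply/colP=> a; move/matrixP/(_ 0 0): (xP (delta_mx a 0)).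
rewrite !mxE /= mulr1n => <-.
rewrite (bigD1 a) //= big1 => [|b ne_ba].
  by rewrite !mxE !eqxx mulr1 addr0.
by rewrite !mxE (negPf ne_ba) mulr0.
Qed.

(* Main.v *)
Require Import Defs.
From mathcomp Require Import all_boot all_order all_algebra all_fingroup.
From mathcomp Require Import mpoly.
From mathcomp Require Import complex.
From mathcomp Require Import boolp classical_sets reals.
From mathcomp Require Import zify ring.

(** Write t_i for the i-th column of the twist of p and let G = (twist p)^T p be
    the matrix of the pairings t_i . p_j.  Up to the sign in the twist, t_i . p_j
    is the determinant of the k - 1 columns cyclically preceding p_i followed by
    p_j.  Hence t_i . p_j = 0 when j is one of these preceding indices
    ([pairing_preceding]), and otherwise, for j >= i not too far to the right, the
    sign of the twist is exactly the sign of the cyclic shift that sorts the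
    columns, so that t_i . p_j is the Pluecker coordinate occurring in phi
    ([pairing_later]).  In particular t_i . p_i = [cyc i], and with
    D = diag([cyc i]) the matrix phi(p) is D^-1 G with the entries on and below the
    k-th subdiagonal replaced by zero ([phiE]).  This cut does not affect the last k
    columns, which are those of D^-1 (twist p)^T p.

    Let h = b w phi(p)^T be unitriangular with b lower triangular.  The first k
    rows of w phi(p)^T are multiples of the transposes of the last k columns of
    phi(p), and b only combines them with earlier rows.  Therefore the first k
    rows of h are A (twist p) D^-1 for some k x k matrix A ([first_rows_eta]), and
    their I-th minor is det A [I](twist p) / prod_(i in I) [cyc i].  As h is
    unitriangular, the case of the initial set says that this is 1, while the
    initial block of G is triangular and gives
    [init](twist p) [init](p) = prod_(i in init) [cyc i]; so det A = [init](p),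
    which is the claimed identity.

    The existence of h is not taken for granted: it is given explicitly
    ([eta_exists]).  Its i-th row is proportional to t_j . p_c / [cyc j], for
    j >= i, where c is the index i shifted back by k.  For i < k this is a column
    of phi(p).  For i >= k, the full column c of D^-1 G is a combination of the
    last k columns of phi(p), and subtracting column c of phi(p) leaves precisely
    the entries with j >= i.

    For the coordinate ring, [I](twist p) [init](p) is the determinant of the
    pairings t_i . p_j for i in I and j < k.  Each of them is zero or plus or
    minus a Pluecker coordinate ([pairing_linear]), so the determinant is a form of
    degree k; multiplying by [cyc i] for i outside I gives a numerator of degree n over
    the product of all the [cyc i]. *)

Local Open Scope ring_scope.

Section Twists.
Set Implicit Arguments.
Unset Strict Implicit.
Import GRing.Theory.

(** * Cyclic shifts of indices *)

Section CyclicShift.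
Variable n : nat.
Implicit Types i : 'I_n.

Lemma val_iter_ord_pred b i : (b <= n)%N ->
  (iter b (@ord_pred n) i : nat)
  = if (b <= i)%N then (i - b)%N else (i + n - b)%N.
Proof.
have lt_in := ltn_ord i.
elim: b => [|b IHb] le_bn; first by rewrite subn0.
rewrite /= IHb ?(ltnW le_bn) //.
have [le_bi|lt_ib] := leqP b i; have [lt_bi|le_ib] := leqP b.+1 i.
- rewrite (_ : (i - b + n).-1 = (i - b.+1) + n)%N; last by lia.
  by rewrite modnDr modn_small; lia.
- by rewrite modn_small; lia.
- by lia.
- rewrite (_ : (i + n - b + n).-1 = (i + n - b.+1) + n)%N; last by lia.
  by rewrite modnDr modn_small; lia.
Qed.

Lemma val_iter_ord_pred_le b i :
  (b <= i)%N -> (iter b (@ord_pred n) i : nat) = (i - b)%N.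
Proof.
by move=> le_bi; rewrite val_iter_ord_pred ?le_bi //; have := ltn_ord i; lia.
Qed.

Lemma val_iter_ord_pred_gt b i :
  (i < b)%N -> (b <= n)%N -> (iter b (@ord_pred n) i : nat) = (i + n - b)%N.
Proof. by move=> lt_ib le_bn; rewrite val_iter_ord_pred // leqNgt lt_ib. Qed.

End CyclicShift.

Section Rotation.
Variables (F : fieldType) (k : nat).

Lemma val_iter_ordS m (b : 'I_k) : (iter m (@ordS k) b : nat) = ((b + m) %% k)%N.
Proof.
elim: m => [|m IHm] /=; first by rewrite addn0 modn_small.
by rewrite IHm -addn1 modnDml addn1 addnS.
Qed.

(** Shifting the columns cyclically by one step is a cycle of length k, of
    signature (-1)^(k-1); it is written below as the lift of the identity that
    sends the last index to the first. *)
Lemma det_colsub_iter_ordS m (A : 'M[F]_k) :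
  \det (colsub (iter m (@ordS k)) A) = (-1) ^+ (m * k.-1)%N * \det A.
Proof.
have step (B : 'M[F]_k) : \det (colsub (@ordS k) B) = (-1) ^+ k.-1 * \det B.
  case: k B => [|k'] B; first by rewrite !det_mx00 mulr1.
  pose c : {perm 'I_k'.+1} := lift_perm ord_max ord0 1%g.
  have cE : c =1 @ordS k'.+1.
    move=> b; apply: val_inj => /=; case: (unliftP ord_max b) => [b'|] ->.
      by rewrite /c lift_perm_lift perm1 lift_max modn_small // ltnS.
    by rewrite /c lift_perm_id /= modnn.
  have -> : colsub (@ordS k'.+1) B = col_perm c B.
    by apply/matrixP=> i j; rewrite !mxE cE.
  rewrite col_permE det_mulmx det_perm mulrC odd_permV.
  by rewrite /c odd_lift_perm odd_perm1 /= !addbF signr_odd.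
elim: m A => [|m IHm] A.
  by rewrite mul0n mul1r; congr (\det _); apply/matrixP=> i j; rewrite !mxE.
have -> : colsub (iter m.+1 (@ordS k)) A
    = colsub (iter m (@ordS k)) (colsub (@ordS k) A).
  by apply/matrixP=> i j; rewrite !mxE.
by rewrite IHm step mulrA -exprD mulSn addnC.
Qed.

End Rotation.

(** * Minors and Pluecker coordinates *)

Section Pluecker.
Variables (F : fieldType) (k n : nat).
Implicit Types (p : 'M[F]_(k, n)) (s : 'I_k -> 'I_n) (I : {set 'I_n}).

Lemma sorted_enum_set I : sorted (fun i j : 'I_n => (i < j)%N) (enum I).
Proof.
rewrite /enum_mem; apply: sorted_filter; first by move=> x y z; apply: ltn_trans.
by have := iota_ltn_sorted 0 n; rewrite -val_enum_ord sorted_map enumT.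
Qed.

Lemma plucker_increasing s I p :
    (forall b c : 'I_k, (b < c)%N -> (s b < s c)%N) ->
    (forall x, (x \in I) = [exists b, x == s b]) ->
  plucker I p = \det (colsub s p).
Proof.
move=> s_mono IE; congr (\det _); apply/matrixP=> a b; rewrite !mxE.
have -> : enum I = [seq s b | b <- enum 'I_k].
  apply: (@irr_sorted_eq _ (fun i j : 'I_n => (i < j)%N)).
  - by move=> x y z; apply: ltn_trans.
  - by move=> x; rewrite /= ltnn.
  - exact: sorted_enum_set.
  - have srt : sorted (fun i j : 'I_k => (i < j)%N) (enum 'I_k).
      by have := iota_ltn_sorted 0 k; rewrite -val_enum_ord sorted_map.
    by apply: homo_sorted srt => c d; apply: s_mono.
  move=> x; rewrite mem_enum IE; apply/fintype.existsP/mapP.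
    by case=> c /eqP->; exists c; rewrite ?mem_enum.
  by case=> c _ ->; exists c.
rewrite -map_comp (nth_map b) ?size_enum_ord //=.
by congr (p a (s _)); apply: val_inj; rewrite /= nth_enum_ord.
Qed.

Lemma pluckerE I (cardI : #|I| = k) p :
  plucker I p = \det (colsub (fun b => enum_val (cast_ord (esym cardI) b)) p).
Proof.
congr (\det _); apply/matrixP=> a b; rewrite !mxE.
rewrite (nth_map (enum_val (cast_ord (esym cardI) b))) -?cardE ?cardI //.
congr (p a _).
by rewrite [RHS](enum_val_nth (enum_val (cast_ord (esym cardI) b))).
Qed.

Lemma plucker_mulmx (A : 'M[F]_k) I p :
  #|I| = k -> plucker I (A *m p) = \det A * plucker I p.
Proof. by move=> cI; rewrite !(pluckerE cI) -mulmx_colsub det_mulmx. Qed.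

Lemma plucker_mul_diag (d : 'rV[F]_n) I p : #|I| = k ->
  plucker I (p *m diag_mx d) = plucker I p * \prod_(i in I) d 0 i.
Proof.
move=> cI; rewrite !(pluckerE cI); set e := (fun b : 'I_k => enum_val _).
have -> : colsub e (p *m diag_mx d)
    = colsub e p *m diag_mx (\row_b d 0 (e b)).
  by rewrite !mul_mx_diag; apply/matrixP=> a b; rewrite !mxE.
rewrite det_mulmx det_diag [in RHS]big_enum_val /=; congr (_ * _).
rewrite [RHS](reindex (cast_ord (esym cI))) /=; last first.
  by apply: onW_bij; exists (cast_ord cI) => b; rewrite (cast_ordK, cast_ordKV).
by apply: eq_bigr => b _; rewrite mxE.
Qed.

Lemma det_colsub_noninj s p : ~~ injectiveb s -> \det (colsub s p) = 0.
Proof.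
case/injectivePn=> b [c neq_bc eq_s]; rewrite -det_tr.
by apply: (determinant_alternate neq_bc) => a; rewrite !mxE eq_s.
Qed.

(** The permutation sorting [s] depends on [s] and [I] only, so the sign can be
    chosen before [p]; this makes the left-hand side a linear form in the Pluecker
    coordinates. *)
Lemma det_colsub_perm s I (cardI : #|I| = k) :
    injective s -> (forall b, s b \in I) ->
  exists e : bool, forall p, \det (colsub s p) = (-1) ^+ e * plucker I p.
Proof.
move=> s_inj sI.
have f_inj : injective (fun b => cast_ord cardI (enum_rank_in (sI b) (s b))).
  move=> b c /cast_ord_inj /(congr1 enum_val).
  by rewrite !enum_rankK_in //; apply: s_inj.
exists (perm f_inj) => p; rewrite (pluckerE cardI) -odd_permV -det_perm mulrC.
rewrite -det_mulmx -col_permE; congr (\det _); apply/matrixP=> a b.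
by rewrite !mxE permE cast_ordK enum_rankK_in.
Qed.


End Pluecker.

(** * The pairings of the twisted columns with the columns *)

Section Pairing.
Variables (F : fieldType) (k n : nat).
Hypotheses (k_gt0 : (0 < k)%N) (le_kn : (k <= n)%N).
Implicit Types (p : 'M[F]_(k, n)) (i j : 'I_n).

(** The columns whose determinant is the pairing of the i-th cross product with
    p_j. *)
Definition window i j (b : 'I_k) : 'I_n :=
  if (b < k.-1)%N then iter (k.-1 - b) (@ord_pred n) i else j.

Definition pairing p : 'M[F]_n := (twist p)^T *m p.

Lemma pairingE p i j :
  pairing p i j = twist_sign F k i.+1 * \det (colsub (window i j) p).
Proof.
pose v b := col (iter (k.-1 - b)%N (@ord_pred n) i) p.
have /matrixP/(_ 0 0) := (crossP v (cross v) k_gt0).1 erefl (col j p).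
rewrite [RHS]mxE mulr1n => detE.
rewrite (_ : colsub _ _ = cols_with_last v (col j p)); last first.
  by apply/matrixP=> a b; rewrite !mxE /window; case: ifP.
rewrite -detE !mxE mulr_sumr; apply: eq_bigr => a _.
by rewrite !mxE mulrA.
Qed.

Lemma pairing_preceding p i b :
  (0 < b < k)%N -> pairing p i (iter b (@ord_pred n) i) = 0.
Proof.
case/andP=> b_gt0 lt_bk; rewrite pairingE det_colsub_noninj ?mulr0 //.
have lt_k1 : (k.-1 < k)%N by lia.
have lt_c : (k.-1 - b < k)%N by lia.
apply/injectivePn; exists (Ordinal lt_k1), (Ordinal lt_c).
  by rewrite -val_eqE /=; lia.
rewrite /window /= ltnn (_ : (k.-1 - b < k.-1)%N); last by lia.
by congr (iter _ _ _); lia.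
Qed.

(** In the band i < j + k where phi is given by minors, the indices j < i precede i
    directly and the indices j > i + n - k precede it by wrapping around; for all
    the others [pairing_later] applies. *)
Lemma preceding_or_later i j : (i < j + k)%N ->
  (exists2 b, (0 < b < k)%N & j = iter b (@ord_pred n) i)
  \/ (i <= j)%N /\ (j + k <= n + i)%N.
Proof.
have [lt_in lt_jn] := (ltn_ord i, ltn_ord j) => lt_ijk.
have [lt_ji|le_ij] := ltnP j i.
  left; exists (i - j)%N; first by lia.
  by apply: val_inj; rewrite /= val_iter_ord_pred; [case: leqP|]; lia.
have [le_jk|lt_jk] := leqP (j + k) (n + i); first by right.
left; exists (i + n - j)%N; first by lia.
by apply: val_inj; rewrite /= val_iter_ord_pred; [case: leqP|]; lia.
Qed.

Lemma mem_cycD1 i x :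
  (x \in cyc k i :\ i)
  = [exists b : 'I_k, (b < k.-1)%N && (x == iter (k.-1 - b) (@ord_pred n) i)].
Proof.
have lt_in := ltn_ord i.
rewrite !inE; apply/andP/fintype.existsP.
  case=> ne_xi /imsetP[m _ xE].
  have lt_mk := ltn_ord m.
  have m_gt0 : (0 < m)%N.
    by case: (posnP m) xE ne_xi => // -> ->; rewrite eqxx.
  have lt_b : (k.-1 - m < k)%N by lia.
  exists (Ordinal lt_b); rewrite /= xE; apply/andP; split; first by lia.
  by apply/eqP; congr (iter _ _ _) => /=; lia.
case=> b /andP[lt_b /eqP->].
have lt_m : (k.-1 - b < k)%N by lia.
split; last by apply/imsetP; exists (Ordinal lt_m).
by rewrite -val_eqE /= val_iter_ord_pred; [case: leqP|]; lia.
Qed.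

Lemma cyc_self i : i \in cyc k i.
Proof. by apply/imsetP; exists (Ordinal k_gt0). Qed.

(** For i + 1 >= k the window is increasing.  Otherwise it is
    n - k + i + 1, ..., n - 1, 0, ..., i - 1, j, and it becomes increasing after
    moving its first m = k - i - 1 entries to the end.  This shift has sign
    (-1)^(m (k - 1)), which agrees with the sign (-1)^((i + 1) m) of the twist
    because k - 1 = i + m and m (m - 1) is even. *)
Lemma pairing_later p i j : (i <= j)%N -> (j + k <= n + i)%N ->
  pairing p i j = plucker (j |: (cyc k i :\ i)) p.
Proof.
have [lt_in lt_jn] := (ltn_ord i, ltn_ord j) => le_ij le_jk.
have windowE x : (x \in j |: (cyc k i :\ i)) = [exists b, x == window i j b].
  rewrite in_setU1 mem_cycD1; apply/orP/fintype.existsP.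
    case=> [/eqP->|/fintype.existsP[b /andP[lt_b xE]]]; last first.
      by exists b; rewrite /window lt_b.
    have lt_k1 : (k.-1 < k)%N by lia.
    by exists (Ordinal lt_k1); rewrite /window /= ltnn.
  case=> b; rewrite /window; case: ifP => lt_b xE; last by left.
  by right; apply/fintype.existsP; exists b; rewrite lt_b.
rewrite pairingE /twist_sign; have [lt_ik|le_ki] := leqP i.+1 k.-1; last first.
  rewrite mul1r; symmetry; apply: plucker_increasing windowE => b c lt_bc.
  have := ltn_ord c; rewrite /window => lt_ck.
  rewrite (_ : (b < k.-1)%N) /=; last by lia.
  rewrite val_iter_ord_pred_le; last by lia.
  have [lt_c|le_c] := ltnP c k.-1; last by lia.
  by rewrite val_iter_ord_pred_le; lia.
pose m := (k - i.+1)%N.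
have sgnE : (-1) ^+ (i.+1 * (k - i.+1))%N = (-1) ^+ (m * k.-1) :> F.
  rewrite -signr_odd -[RHS]signr_odd; congr (_ ^+ _); congr nat_of_bool.
  rewrite -/m (_ : k.-1 = i + m)%N; last by lia.
  by rewrite !oddM oddD /=; case: (odd i); case: (odd m).
rewrite sgnE -det_colsub_iter_ordS -colsub_comp; symmetry.
apply: plucker_increasing => [b c lt_bc | x].
  have lt_ck := ltn_ord c.
  have valE (d : 'I_k) : ((window i j \o iter m (@ordS k)) d : nat)
      = if (d < i)%N then d : nat
        else if (d == i :> nat)%N then j : nat else (n - k + d)%N.
    have lt_dk := ltn_ord d.
    rewrite /= /window val_iter_ordS /m.
    have [lt_di|le_id] := ltnP d i.
      rewrite modn_small; last by lia.
      by rewrite (_ : (_ < _)%N) ?val_iter_ord_pred_le; lia.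
    have [eq_di|ne_di] := eqVneq (d : nat) i.
      rewrite modn_small; last by lia.
      by rewrite (_ : (_ < _)%N = false) //; lia.
    rewrite (_ : (d + (k - i.+1)) = (d - i.+1) + k)%N; last by lia.
    rewrite modnDr modn_small; last by lia.
    by rewrite (_ : (_ < _)%N) ?val_iter_ord_pred_gt; lia.
  rewrite !valE; have [?|?] := ltnP b i; have [?|?] := ltnP c i;
    by have [?|?] := eqVneq (b : nat) i; have [?|?] := eqVneq (c : nat) i; lia.
rewrite windowE; apply/fintype.existsP/fintype.existsP => [[b xE]|[b xE]]; last first.
  by exists (iter m (@ordS k) b).
exists (iter m (@ord_pred k) b) => /=.
suff -> : iter m (@ordS k) (iter m (@ord_pred k) b) = b by [].
by elim: (m) (b) => //= q IHq c; rewrite -iterS iterSr ord_predK.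
Qed.

Lemma pairing_diag p i : pairing p i i = plucker (cyc k i) p.
Proof.
rewrite pairing_later //; last by rewrite addnC leq_add2r.
by rewrite finset.setD1K ?cyc_self.
Qed.

(** The window of i followed by the index k steps back is a cyclic shift of the
    window of the predecessor of i, whose determinant is, up to sign, a cyclic
    Pluecker coordinate. *)
Lemma pairing_wrap_neq0 p i :
  plucker (cyc k (ord_pred i)) p != 0 ->
  pairing p i (iter k (@ord_pred n) i) != 0.
Proof.
rewrite -pairing_diag !pairingE.
have -> : colsub (window i (iter k (@ord_pred n) i)) p
   = colsub (iter 1 (@ordS k)) (colsub (window (ord_pred i) (ord_pred i)) p).
  rewrite -colsub_comp; apply/matrixP=> a b; rewrite !mxE; congr (p a _).
  have lt_bk := ltn_ord b; rewrite /window /=.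
  have [lt_b|le_b] := ltnP b k.-1.
    rewrite modn_small; last by lia.
    have [lt_b1|le_b1] := ltnP b.+1 k.-1.
      by rewrite -iterSr; congr (iter _ _ _); lia.
    by rewrite (_ : k.-1 - b = 1)%N //; lia.
  have -> : (b.+1 %% k = 0)%N by rewrite (_ : b.+1 = k) ?modnn //; lia.
  case: ltnP => ?; rewrite -?iterSr; first by congr (iter _ _ _); lia.
  by rewrite (_ : k = 1)%N //; lia.
rewrite det_colsub_iter_ordS !mulf_eq0 !negb_or => /andP[_ det_neq0].
rewrite det_neq0 signr_eq0 andbT /= /twist_sign.
by case: ifP; rewrite ?signr_eq0 ?oner_eq0.
Qed.

Lemma phiE p i j :
  phi p i j = if (i < j + k)%N then pairing p i j / pairing p i i else 0.
Proof.
have [lt_in lt_jn] := (ltn_ord i, ltn_ord j).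
rewrite mxE; case: ifP => // lt_ijk; rewrite mem_cycD1 pairing_diag.
have [[b b_range jE]|[le_ij le_jk]] := preceding_or_later lt_ijk.
  rewrite [in RHS]jE pairing_preceding // mul0r ifT //.
  have lt_c : (k.-1 - b < k)%N by lia.
  apply/fintype.existsP; exists (Ordinal lt_c) => /=; apply/andP; split; first by lia.
  by rewrite jE; apply/eqP; congr (iter _ _ _); lia.
rewrite pairing_later // ifF //; apply/fintype.existsP=> -[b /andP[lt_b /eqP jE]].
have: (j : nat) = iter (k.-1 - b) (@ord_pred n) i by rewrite jE.
have [?|?] := leqP (k.-1 - b) i.
  by rewrite val_iter_ord_pred_le; lia.
by rewrite val_iter_ord_pred_gt; lia.
Qed.

End Pairing.

(** * The unitriangular representative defining the BFZ-twist *)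

Section BFZTwist.
Variables (F : fieldType) (k n : nat).
Hypotheses (k_gt0 : (0 < k)%N) (le_kn : (k <= n)%N).
Variables (W : 'M[F]_n) (W_lift : is_lift k W).
Implicit Types (p : 'M[F]_(k, n)) (g h : 'M[F]_n) (i j : 'I_n).

Local Notation winv i := (iter k (@ord_pred n) i).

(** [winv i] is the image of [i] under the inverse of the permutation w. *)
Lemma lift_neq0 i j : (W i j != 0) = (j == winv i).
Proof.
have [lt_in lt_jn] := (ltn_ord i, ltn_ord j).
rewrite W_lift.2 -val_eqE /=.
have modE : ((j + k) %% n = if j + k < n then j + k else j + k - n)%N.
  case: ltnP => ?; first by rewrite modn_small.
  by rewrite -{1}(@subnK n (j + k)%N) // modnDr modn_small //; lia.
have [?|?] := leqP k i.
  by rewrite val_iter_ord_pred_le // modE; case: ifP => ?; apply/eqP/eqP; lia.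
by rewrite val_iter_ord_pred_gt // modE; case: ifP => ?; apply/eqP/eqP; lia.
Qed.

Lemma mul_lift_tr g i j : (W *m g^T) i j = W i (winv i) * g j (winv i).
Proof.
rewrite mxE (bigD1 (winv i)) //= mxE big1 ?addr0 // => c ne_c.
have := lift_neq0 i c; rewrite (negPf ne_c) => /negbFE/eqP->.
by rewrite mul0r.
Qed.

Lemma mul_lower_lift_tr (b : 'M[F]_n) g i j :
  (b *m W *m g^T) i j = \sum_s b i s * (W s (winv s) * g j (winv s)).
Proof.
by rewrite -mulmxA mxE; apply: eq_bigr => s _; rewrite mul_lift_tr.
Qed.

Lemma val_winv_lt i : (i < k)%N -> (winv i : nat) = (i + n - k)%N.
Proof. by move=> lt_ik; rewrite val_iter_ord_pred_gt. Qed.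

Lemma val_winv_ge i : (k <= i)%N -> (winv i : nat) = (i - k)%N.
Proof. exact: val_iter_ord_pred_le. Qed.

Lemma gr_star_cyc p i : gr_star p -> plucker (cyc k i) p != 0.
Proof. by case/andP=> _ /forallP. Qed.

Lemma gr_star_pairing_diag p i : gr_star p -> pairing p i i != 0.
Proof. by move=> p_star; rewrite pairing_diag // gr_star_cyc. Qed.

Lemma phi_last_cols p i j : (i < k)%N ->
  phi p j (winv i) = pairing p j (winv i) / pairing p j j.
Proof.
move=> lt_ik; rewrite phiE // ifT // val_winv_lt //.
by have := ltn_ord j; lia.
Qed.

(** The last k columns of p form the window of the last index, so their
    determinant is a nonzero diagonal pairing. *)
Lemma last_cols_unit p : gr_star p ->
  colsub (fun b => winv (widen_ord le_kn b)) p \in unitmx.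
Proof.
move=> p_star; have lt_n1 : (n.-1 < n)%N by lia.
pose l := Ordinal lt_n1.
have := gr_star_pairing_diag l p_star; rewrite pairingE // mulf_eq0 negb_or.
case/andP=> _; rewrite unitmxE unitfE; congr (\det _ != 0).
apply/matrixP=> a b; rewrite !mxE; congr (p a _); apply: val_inj.
have lt_bk := ltn_ord b.
rewrite /= val_winv_lt //= /window; case: ifP => lt_b /=; last by lia.
by rewrite val_iter_ord_pred_le /=; lia.
Qed.

Lemma pairing_winv_lt p i j :
  (j < i)%N -> (i < k)%N -> pairing p j (winv i) = 0.
Proof.
move=> lt_ji lt_ik; have lt_in := ltn_ord i.
have jE : j = iter (i - j) (@ord_pred n) i.
  by apply: val_inj; rewrite /= val_iter_ord_pred_le; lia.
rewrite (_ : winv i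
   = iter (k - (i - j)) (@ord_pred n) (iter (i - j) (@ord_pred n) i)).
  by rewrite -jE pairing_preceding //; lia.
by rewrite -iterD; congr (iter _ _ _); lia.
Qed.

(** The last k columns of p form a basis, and the pairings are linear in p_j. *)
Lemma pairing_last_cols p i : gr_star p ->
  exists z : 'I_k -> F, forall j,
    \sum_b z b * pairing p j (winv (widen_ord le_kn b)) = pairing p j (winv i).
Proof.
move=> p_star; pose e (b : 'I_k) := winv (widen_ord le_kn b).
exists (fun b => (invmx (colsub e p) *m col (winv i) p) b 0) => j.
have /matrixP/(_ j 0) :
    colsub e (pairing p) *m (invmx (colsub e p) *m col (winv i) p)
   = col (winv i) (pairing p).
  rewrite /pairing -mulmx_colsub -mulmxA mulKVmx ?last_cols_unit //.
  by rewrite !colEsub mulmx_colsub.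
rewrite mxE [RHS]mxE => <-; apply: eq_bigr => b _.
by rewrite mulrC [in RHS]mxE.
Qed.

(** In the proof, [h i j] is the i-th row before normalization: column [winv i]
    of D^-1 G if i < k, and otherwise what is left of it after subtracting the
    same column of phi(p).  [C] expresses these rows, up to the scalars
    in w, through the rows of w phi(p)^T: the i-th one, and for i >= k also the
    first k, hence in a lower triangular way; [d i] is the diagonal entry of [h]. *)
Lemma eta_exists p : gr_star p -> exists2 h, upper_unitri h &
  exists2 b, lower_invertible b & h = b *m W *m (phi p)^T.
Proof.
move=> p_star.
have /choice[z zE] : forall i, exists z : 'I_k -> F, forall j,
    \sum_b z b * pairing p j (winv (widen_ord le_kn b)) = pairing p j (winv i).
  by move=> i; apply: pairing_last_cols.
pose C i s : F := if (i < k)%N then (i == s)%:R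
  else oapp (z i) 0 (insub (s : nat)) - (i == s)%:R.
pose d i := pairing p i (winv i) / pairing p i i.
have d_neq0 i : d i != 0.
  rewrite mulf_neq0 ?invr_eq0 ?gr_star_pairing_diag //.
  by rewrite pairing_wrap_neq0 ?gr_star_cyc.
pose h i j := pairing p j (winv i) / pairing p j j
   - (if (i < k)%N then 0 else phi p j (winv i)).
have delta_sum (f : 'I_n -> F) i : \sum_s (i == s)%:R * f s = f i.
  rewrite (bigD1 i) //= eqxx mul1r big1 ?addr0 // => s ne_s.
  by rewrite eq_sym (negPf ne_s) mul0r.
have combE i j : \sum_s C i s * phi p j (winv s) = h i j.
  rewrite /C /h; case: (ltnP i k) => [lt_ik|le_ki].
    by rewrite delta_sum phi_last_cols // subr0.
  under eq_bigr do rewrite mulrBl.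
  rewrite sumrB delta_sum -(zE i) mulr_suml; congr (_ - _).
  rewrite (bigID (fun s : 'I_n => (s < k)%N)) /= [X in _ + X]big1 ?addr0; last first.
    by move=> s le_ks; rewrite insubN ?mul0r.
  rewrite (big_ord_narrow le_kn); apply: eq_bigr => b _.
  by rewrite /= valK /= phi_last_cols //= ?ltn_ord ?mulrA.
pose b := \matrix_(i, s) ((d i)^-1 * C i s / W s (winv s)).
have W_neq0 s : W s (winv s) != 0 by rewrite lift_neq0.
have hE i j : (b *m W *m (phi p)^T) i j = (d i)^-1 * h i j.
  rewrite mul_lower_lift_tr -combE mulr_sumr; apply: eq_bigr => s _.
  by rewrite mxE !mulrA divfK.
exists (b *m W *m (phi p)^T).
  apply/forallP=> i; apply/forallP=> j; apply/implyP=> le_ji; rewrite hE /h.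
  have lt_in := ltn_ord i.
  have [<-|ne_ij] := eqVneq i j.
    case: ltnP => [lt_ik|le_ki]; first by rewrite subr0 mulVf.
    rewrite phiE // val_winv_ge // ifF ?subr0 ?mulVf //; lia.
  have lt_ji : (j < i)%N by move: ne_ij; rewrite -val_eqE /=; lia.
  case: ltnP => [lt_ik|le_ki].
    by rewrite pairing_winv_lt // mul0r subr0 mulr0.
  rewrite phiE // val_winv_ge // ifT ?subrr ?mulr0 //; lia.
exists b => //.
have b_lower : is_trig_mx b.
  apply/is_trig_mxP => i s lt_is; rewrite mxE /C.
  have ne_is : (i == s) = false by apply/eqP=> /(congr1 val) /=; lia.
  case: ltnP => lt_ik; rewrite ne_is; first by rewrite mulr0 mul0r.
  by rewrite insubN ?subr0 ?mulr0 ?mul0r //=; lia.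
apply/andP; split; last first.
  apply/forallP=> i; apply/forallP=> s; apply/implyP=> lt_is; apply/eqP.
  by move/is_trig_mxP: b_lower; apply.
rewrite unitmxE unitfE det_trig // prodf_seq_neq0; apply/allP=> i _ /=.
rewrite mxE !mulf_neq0 ?invr_eq0 // /C eqxx.
case: ltnP => lt_ik; rewrite ?oner_eq0 //.
by rewrite insubN /= ?sub0r ?oppr_eq0 ?oner_eq0 //; lia.
Qed.

(** Since b is lower triangular, only the rows s < k of w phi(p)^T contribute;
    they come from the last k columns of phi(p), on which phi(p) agrees with
    D^-1 (twist p)^T p. *)
Lemma first_rows_eta p h b : lower_invertible b ->
    h = b *m W *m (phi p)^T ->
  exists A : 'M[F]_k, first_rows le_kn h
    = A *m (twist p *m diag_mx (\row_j (plucker (cyc k j) p)^-1)).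
Proof.
move=> /andP[_ /forallP b_low] hE.
exists (\matrix_(a, c)
  \sum_s b (widen_ord le_kn a) s * W s (winv s) * p c (winv s)).
rewrite mul_mx_diag.
apply/matrixP=> a j; rewrite mxE hE mul_lower_lift_tr !mxE.
transitivity (\sum_c \sum_s b (widen_ord le_kn a) s * W s (winv s) *
     (twist p c j * p c (winv s) / plucker (cyc k j) p)).
  rewrite exchange_big /=; apply: eq_bigr => s _; rewrite -mulr_sumr.
  have [lt_as|le_sa] := ltnP (widen_ord le_kn a) s.
    have /forallP/(_ s)/implyP/(_ lt_as)/eqP-> := b_low (widen_ord le_kn a).
    by rewrite !mul0r.
  rewrite mulrA; congr (_ * _).
  rewrite phi_last_cols //; last exact: leq_ltn_trans le_sa (ltn_ord a).
  rewrite -mulr_suml pairing_diag //; congr (_ / _).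
  by rewrite mxE; apply: eq_bigr => c _; rewrite !mxE.
apply: eq_bigr => c _; rewrite !mxE mulr_suml; apply: eq_bigr => s _.
by ring.
Qed.

Lemma plucker_initial p :
  plucker (initial_set k n) p = \det (colsub (widen_ord le_kn) p).
Proof.
apply: plucker_increasing => // x; rewrite inE.
apply/idP/fintype.existsP => [lt_xk | [b /eqP->]]; last exact: (ltn_ord b).
by exists (Ordinal lt_xk); apply/eqP/val_inj.
Qed.

Lemma card_initial_set : #|initial_set k n| = k.
Proof.
have -> : initial_set k n = widen_ord le_kn @: [set: 'I_k].
  apply/setP=> x; rewrite inE; apply/idP/imsetP => [lt_xk | [b _ ->]].
    by exists (Ordinal lt_xk) => //; apply: val_inj.
  exact: (ltn_ord b).
rewrite card_imset ?cardsT ?card_ord //.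
by move=> b c /(congr1 val) /= eq_bc; apply: val_inj.
Qed.

Lemma twist_plucker_mul (I : {set 'I_n}) (cI : #|I| = k) p :
  plucker I (twist p) * plucker (initial_set k n) p
  = \det (mxsub (fun a => enum_val (cast_ord (esym cI) a)) (widen_ord le_kn)
          (pairing p)).
Proof.
by rewrite (pluckerE cI) plucker_initial -det_tr -det_mulmx mxsub_mul trmx_mxsub.
Qed.

(** For j < i < k, the index j is one of the k - 1 indices preceding i, so the
    initial block of the matrix of pairings is triangular. *)
Lemma twist_plucker_initial p :
  plucker (initial_set k n) (twist p) * plucker (initial_set k n) p
  = \prod_(i in initial_set k n) plucker (cyc k i) p.
Proof.
rewrite !plucker_initial -det_tr -det_mulmx trmx_mxsub -mxsub_mul -/(pairing p).
rewrite -det_tr det_trig; last first.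
  apply/is_trig_mxP=> a b lt_ab; rewrite 2!mxE.
  rewrite (_ : widen_ord le_kn a = iter (b - a) (@ord_pred n) (widen_ord le_kn b)).
    by rewrite pairing_preceding //; have := ltn_ord b; lia.
  by apply: val_inj; rewrite /= val_iter_ord_pred_le /=; lia.
rewrite (eq_bigl (fun i : 'I_n => i < k)%N) => [|i]; last by rewrite inE.
by rewrite (big_ord_narrow le_kn); apply: eq_bigr => a _; rewrite 2!mxE pairing_diag.
Qed.

Lemma plucker_first_rows_unitri h : upper_unitri h ->
  plucker (initial_set k n) (first_rows le_kn h) = 1.
Proof.
move=> /forallP h_uni; rewrite plucker_initial -det_tr.
have hE (a b : 'I_k) : (b <= a)%N ->
    h (widen_ord le_kn a) (widen_ord le_kn b) = (a == b)%:R.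
  move=> le_ba; have /forallP := h_uni (widen_ord le_kn a).
  by move/(_ (widen_ord le_kn b))/implyP/(_ le_ba)/eqP.
rewrite det_trig; last first.
  apply/is_trig_mxP=> a b lt_ab; rewrite !mxE hE ?(ltnW lt_ab) //.
  by case: eqP lt_ab => // ->; rewrite ltnn.
by apply: big1 => a _; rewrite !mxE hE ?eqxx.
Qed.

Lemma bfz_twist_ratio (I : {set 'I_n}) p : #|I| = k -> gr_star p ->
  plucker I (bfz_twist le_kn W p)
    / plucker (initial_set k n) (bfz_twist le_kn W p)
  = plucker I (twist p) * plucker (initial_set k n) p
    / \prod_(i in I) plucker (cyc k i) p.
Proof.
move=> cI p_star; rewrite /bfz_twist /eta; set S := (X in xget _ X).
have [h uni_h [b b_low hE]] := eta_exists p_star.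
have : S (xget 1%:M S) by apply: xgetPex; exists h; split=> //; exists b.
move: (xget 1%:M S) => {h uni_h b b_low hE} h [uni_h [b b_low hE]].
have [A rowsE] := first_rows_eta b_low hE.
have pluckE (J : {set 'I_n}) : #|J| = k -> plucker J (first_rows le_kn h)
    = \det A * (plucker J (twist p) / \prod_(i in J) plucker (cyc k i) p).
  move=> cJ; rewrite rowsE plucker_mulmx // plucker_mul_diag // -prodfV.
  by congr (_ * (_ * _)); apply: eq_bigr => i _; rewrite mxE.
have initE := pluckE _ card_initial_set.
have prod_neq0 (J : {set 'I_n}) : \prod_(i in J) plucker (cyc k i) p != 0.
  by apply/prodf_neq0 => i _; apply: gr_star_cyc.
have /= := prod_neq0 (initial_set k n).
rewrite -twist_plucker_initial mulf_eq0 negb_or.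
case/andP=> tw_neq0 init_neq0.
rewrite plucker_first_rows_unitri // divr1 pluckE //.
have -> : \det A = plucker (initial_set k n) p.
  move: initE; rewrite plucker_first_rows_unitri // -twist_plucker_initial.
  rewrite invfM [X in _ * X]mulrA mulfV // mul1r => detA.
  by rewrite -[RHS]mul1r detA mulfVK.
by ring.
Qed.

End BFZTwist.

(** * Membership in the coordinate ring *)

Section Homogeneity.
Variable F : fieldType.

Lemma dhomog_prod_linear (T : finType) (m : nat) (A : pred T)
    (G : T -> {mpoly F[m]}) :
  (forall x, G x \is 1.-homog) -> \prod_(x in A) G x \is #|A|.-homog.
Proof.
move=> G_homog; rewrite -sum1_card.
elim/big_rec2: _ => [|x d P _ P_homog]; first exact: dhomog1.
by apply: dhomogM.
Qed.

Lemma dhomog_det_linear (m d : nat) (M : 'M[{mpoly F[m]}]_d) :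
  (forall a b, M a b \is 1.-homog) -> \det M \is d.-homog.
Proof.
move=> M_homog; apply: rpred_sum => s _; rewrite rpredMsign.
have := @dhomog_prod_linear 'I_d m predT (fun a => M a (s a)).
by rewrite card_ord; apply.
Qed.

End Homogeneity.

Section CoordinateRing.
Variables (F : fieldType) (k n : nat).
Hypotheses (k_gt0 : (0 < k)%N) (le_kn : (k <= n)%N).
Implicit Types (p : 'M[F]_(k, n)) (i j : 'I_n).

Local Notation N := #|ksubsets k n|.
Local Notation pluckers p := (fun t : 'I_N => plucker (enum_val t) p).

Lemma colsub_linear (s : 'I_k -> 'I_n) :
  exists2 L : {mpoly F[N]}, L \is 1.-homog &
    forall p, \det (colsub s p) = L.@[pluckers p].
Proof.
have [/injectiveP s_inj|s_ninj] := boolP (injectiveb s); last first.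
  by exists 0; [apply: dhomog0 | move=> p; rewrite meval0 det_colsub_noninj].
pose I := s @: [set: 'I_k].
have cI : #|I| = k by rewrite card_imset // cardsT card_ord.
have IK : I \in ksubsets k n by rewrite inE cI.
have [|e detE] := det_colsub_perm F cI s_inj.
  by move=> b; apply: imset_f.
exists ((-1) ^+ e *: 'X_(enum_rank_in IK I)).
  by apply: dhomogZ; rewrite dhomogX; apply/eqP; apply: mdeg1.
by move=> p; rewrite detE mevalZ mevalXU enum_rankK_in.
Qed.

Lemma pairing_linear i j : exists2 L : {mpoly F[N]}, L \is 1.-homog &
  forall p, pairing p i j = L.@[pluckers p].
Proof.
have [L L_homog LE] := colsub_linear (window i j).
exists (twist_sign F k i.+1 *: L); first exact: dhomogZ.
by move=> p; rewrite pairingE // mevalZ LE.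
Qed.

(** Multiplying by [init](p) turns the minor of the twist into a determinant of
    pairings, which are linear forms in the Pluecker coordinates.  The diagonal
    pairings in the numerator stand for the factors [cyc i] with i outside I, which
    bring the denominator to the full product. *)
Lemma twist_in_coord_ring (I : {set 'I_n}) : #|I| = k ->
  in_coord_ring (fun p : 'M[F]_(k, n) =>
    plucker I (twist p) * plucker (initial_set k n) p
    / \prod_(i in I) plucker (cyc k i) p).
Proof.
move=> cI.
have /choice[L LP] : forall ij : 'I_n * 'I_n, exists L : {mpoly F[N]},
    L \is 1.-homog /\ forall p, pairing p ij.1 ij.2 = L.@[pluckers p].
  by case=> i j; have [L] := pairing_linear i j; exists L.
pose e a := enum_val (cast_ord (esym cI) a).
pose M := \matrix_(a < k, b < k) L (e a, widen_ord le_kn b).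
exists 1%N, (\det M * \prod_(i in ~: I) L (i, i)); split.
  rewrite (_ : (n * 1 = k + #|~: I|)%N); last first.
    by rewrite muln1 -{1}cI cardsC card_ord.
  apply: dhomogM; last by apply: dhomog_prod_linear => i; case: (LP (i, i)).
  apply: dhomog_det_linear => a b; rewrite mxE.
  by case: (LP (e a, widen_ord le_kn b)).
move=> p p_star; rewrite expr1 mevalM.
have -> : (\prod_(i in ~: I) L (i, i)).@[pluckers p]
    = \prod_(i in ~: I) plucker (cyc k i) p.
  rewrite rmorph_prod; apply: eq_bigr => i _.
  by rewrite -pairing_diag // (LP (i, i)).2.
have -> : (\det M).@[pluckers p]
    = plucker I (twist p) * plucker (initial_set k n) p.
  rewrite (twist_plucker_mul le_kn cI) -det_map_mx; congr (\det _).
  by apply/matrixP=> a b; rewrite [LHS]mxE [M a b]mxE [RHS]mxE (LP (e a, _)).2.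
rewrite [\prod_(i < n) _](bigID (mem I)) /=.
rewrite [X in _ / (_ * X)](eq_bigl (mem (~: I))) => [|i]; last by rewrite /= inE.
rewrite invfM mulrACA mulfV ?mulr1 //.
by apply/prodf_neq0 => i _; case/andP: p_star => _ /forallP.
Qed.

End CoordinateRing.
End Twists.

Theorem proposition5p7 (R : realType) (k n : nat)
    (k_gt0 : (0 < k)%N) (le_kn : (k <= n)%N)
    (W : 'M[R[i]]_n) (W_lift : is_lift k W)
    (I : {set 'I_n}) (card_I : #|I| = k) :
  eq_in_coord_ring
    (fun p : 'M[R[i]]_(k, n) =>
       plucker I (bfz_twist le_kn W p)
       / plucker (initial_set k n) (bfz_twist le_kn W p))
    (fun p : 'M[R[i]]_(k, n) =>
       plucker I (twist p) * plucker (initial_set k n) p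
       / \prod_(i in I) plucker (cyc k i) p).
Proof.
have ratioE p := @bfz_twist_ratio _ k n k_gt0 le_kn W W_lift I p card_I.
have ring_r := @twist_in_coord_ring R[i] k n k_gt0 le_kn I card_I.
split=> //; have [m [P [P_homog PE]]] := ring_r.
by exists m, P; split=> // p p_star; rewrite ratioE // PE.
Qed.
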